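(* Let $G$ be a finite abelian group and let $A_1,\dots,A_m$ be pairwise disjoint nonempty subsets of $G$ with sizes $k_1,\dots,k_m$. Then the collection is bimodal if and only if for each $j$ with $k_j>1$, the set $B_j=\bigcup_{i\neq j}A_i$ is a union of cosets of the subgroup $H_j$.
   Context: $G$ is written additively, $G^*=G\setminus\{0\}$. For $\delta\in G^*$, $N_j(\delta)=|\{(a,b): a\in A_j,\ b\in A_i \text{ for some } i\neq j,\ a-b=\delta\}|$. The collection is bimodal if $N_j(\delta)\in\{0,k_j\}$ for all $\delta\in G^*$ and all $j$. $H_j$ (the internal difference group of $A_j$) is the subgroup of $G$ generated by $\{g_1-g_2: g_1,g_2\in A_j,\ g_1\neq g_2\}$. *)

(* Defs.v *)
From mathcomp Require Import all_boot all_order all_algebra all_fingroup.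

Set Implicit Arguments.
Unset Strict Implicit.
Unset Printing Implicit Defensive.

Import GRing.Theory.
Local Open Scope ring_scope.

Section Bimodal.

Variables (G : finZmodType) (m : nat) (A : 'I_m -> {set G}).

Definition ext_diff_count (j : 'I_m) (delta : G) : nat :=
  #|[set p : G * G | [&& p.1 \in A j,
                         [exists i, (i != j) && (p.2 \in A i)]
                       & p.1 - p.2 == delta]]|.

Definition bimodal : Prop :=
  forall (j : 'I_m) (delta : G), delta != 0 ->
    ext_diff_count j delta = 0%N \/ ext_diff_count j delta = #|A j|.

(* The group generation <<_>> is taken in the additive group of G: a
   finZmodType is canonically a finGroupType whose law is +%R. *)
Definition int_diff_group (j : 'I_m) : {group G} :=
  <<[set g1 - g2 | g1 in A j, g2 in A j & g1 != g2]>>%G.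

Definition others_union (j : 'I_m) : {set G} := \bigcup_(i | i != j) A i.

End Bimodal.

(* Empty unions are allowed. As G is abelian, right cosets H :* x = x + H are
   also left cosets. *)
Definition union_of_cosets (G : finZmodType) (B : {set G}) (H : {group G}) :
    Prop :=
  exists2 P : {set {set G}}, P \subset rcosets H [set: G] & B = cover P.

(* Main.v *)
Require Import Defs.
From mathcomp Require Import all_boot all_order all_algebra all_fingroup.

(** Write [B] for the union of the [A i] with [i != j].  The count [N_j(delta)]
    is the number of [a] in [A j] with [a - delta] in [B], so bimodality at [j]
    says that [a - delta] in [B] for one [a] in [A j] implies it for all of
    them.  Taking [delta = a - b] with [b] in [B], which is nonzero because
    [A j] and [B] are disjoint, this is stability of [B] under translation by
    all differences [a' - a], that is, under translation by [H_j]. *)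

Section TranslationStability.

Local Open Scope ring_scope.
Import GRing.Theory.

Variable G : finZmodType.
Implicit Types (B S : {set G}) (H : {group G}).

Definition translation_stable {G : finZmodType} (B S : {set G}) : Prop :=
  forall x b, x \in S -> b \in B -> x + b \in B.

(** Translating by an element of [H] stays inside a coset of [H]. Conversely, a stable [B] is
    covered by the cosets of its own elements, and stability keeps these cosets inside [B]. *)
Lemma union_of_cosetsP B H :
  union_of_cosets B H <-> translation_stable B H.
Proof.
split=> [[P /subsetP sPH ->] x b Hx /bigcupP[C PC Cb] | stabB].
  apply/bigcupP; exists C => //.
  have /rcosetsP[y _ defC] := sPH C PC; rewrite defC in Cb *.
  by rewrite -FinRing.zmodMgE mem_rcoset -mulgA groupM // -mem_rcoset.
exists [set (H :* b)%g | b in B].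
  by apply/subsetP=> _ /imsetP[b _ ->]; apply/rcosetsP; exists b; rewrite ?inE.
apply/setP=> z; apply/idP/bigcupP => [Bz | [_ /imsetP[b Bb ->]]].
  by exists (H :* z)%g; [apply/imsetP; exists z | apply: rcoset_refl].
by case/rcosetP=> h Hh ->; rewrite FinRing.zmodMgE; apply: stabB.
Qed.

(** As [G] is finite, each element of the generated group is a sum of elements of [S], without
    negatives, so the summands can be applied one at a time. *)
Lemma translation_stable_gen B S :
  translation_stable B <<S>>%g <-> translation_stable B S.
Proof.
split=> stabB x b Sx; first by apply: stabB; rewrite mem_gen.
case/gen_prodgP: Sx => n [c Sc ->].
elim/big_rec: _ => [|i y _ IHy] Bb; first by rewrite FinRing.zmod1gE add0r.
by rewrite FinRing.zmodMgE -addrA; apply: stabB (Sc i) (IHy Bb).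
Qed.

End TranslationStability.

Section ExternalDifferences.

Local Open Scope ring_scope.
Import GRing.Theory.

Variables (G : finZmodType) (m : nat) (A : 'I_m -> {set G}).

(** A counted pair is determined by its first entry [a], the second being [a - d]. *)
Lemma ext_diff_countE (j : 'I_m) (d : G) :
  ext_diff_count A j d = #|[set a in A j | a - d \in others_union A j]|.
Proof.
rewrite -(card_imset _ (f := fun a => (a, a - d))); last by move=> a b [].
apply: eq_card => -[a b]; rewrite inE /=; apply/and3P/imsetP.
  case=> Aa /exists_inP[i ij Ab] /eqP <-; exists a; last by rewrite subKr.
  by rewrite inE Aa subKr; apply/bigcupP; exists i.
case=> a'; rewrite inE => /andP[Aa' /bigcupP[i ij Ab]] [-> ->].
by split=> //; [apply/exists_inP; exists i | rewrite subKr].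
Qed.

Lemma int_diff_group_stableP (j : 'I_m) (B : {set G}) :
  translation_stable B (int_diff_group A j) <->
  (forall a a' b, a \in A j -> a' \in A j -> b \in B -> a' - a + b \in B).
Proof.
apply: (iff_trans (translation_stable_gen _ _ _)); split=> stabB.
  (* The generators come from distinct pairs only; equal elements give the translation by 0. *)
  move=> a a' b Aa Aa' Bb; have [->|ne] := eqVneq a' a.
    by rewrite subrr add0r.
  by apply: stabB Bb; apply: imset2_f => //; rewrite inE Aa ne.
move=> x b /imset2P[a' a Aa']; rewrite inE => /andP[Aa _] ->.
exact: stabB.
Qed.

End ExternalDifferences.

Theorem mainTheorem10 (G : finZmodType) (m : nat) (A : 'I_m -> {set G})
    (A_nonempty : forall j : 'I_m, A j != set0)
    (A_disjoint : forall i j : 'I_m, i != j -> [disjoint A i & A j]) :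
  bimodal A <->
  (forall j : 'I_m, 1 < #|A j| ->
     union_of_cosets (others_union A j) (int_diff_group A j)).
Proof.
split=> [bimA j _ | cosA j d _].
  apply/union_of_cosetsP/int_diff_group_stableP => a a' b Aa Aa' Bb.
  have nz : (a - b)%R != 0%R.
    rewrite GRing.subr_eq0; apply: contraTneq Bb => <-.
    by apply/bigcupP=> -[i /A_disjoint/disjointFl/(_ Aa)->].
  have := bimA j _ nz; rewrite ext_diff_countE.
  set S := finset _ => cardS.
  have Sa : a \in S by rewrite inE Aa GRing.subKr.
  (* Since [a] lies in [S], the count is not 0, so bimodality forces [S] to be all of [A j].
     Membership of [a'] then says that [a' - (a - b)] is in the union. *)
  have /eqP/setP/(_ a') : S == A j.
    rewrite eqEcard; apply/andP; split; first by apply/subsetP=> x; rewrite inE => /andP[].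
    by case: cardS => [/eqP|->//]; rewrite cards_eq0 => /eqP S0; rewrite S0 inE in Sa.
  by rewrite inE Aa' /= GRing.opprB GRing.addrA GRing.addrAC.
rewrite ext_diff_countE.
set S := finset _.
have sSA : S \subset A j by apply/subsetP=> x; rewrite inE => /andP[].
have [->|[a Sa]] := set_0Vmem S; first by left; rewrite cards0.
right; apply/eqP; rewrite eqn_leq subset_leq_card //=.
(* If [A j] has more than one element, use [a' - d = (a' - a) + (a - d)]; otherwise the nonempty [S]
   already has full size. *)
have [/cosA/union_of_cosetsP/int_diff_group_stableP stabB | le1] := ltnP 1 #|A j|.
  apply/subset_leq_card/subsetP => a' Aa'.
  move: Sa; rewrite !inE Aa' => /andP[Aa Ba].
  by have := stabB _ _ _ Aa Aa' Ba; rewrite GRing.addrA GRing.subrK.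
by apply: leq_trans le1 _; apply/card_gt0P; exists a.
Qed.
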